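(* Let $n$ be a positive integer, let $S\subseteq\{1,\dots,n-1\}$ be closed under taking additive inverses modulo $n$, let $G=\operatorname{Circ}(n,S)$, let $\omega=e^{2\pi i/n}$, and let $k$ be a nonnegative integer. The following are equivalent. (1) There exists a real (symmetric) positive semidefinite circulant matrix with rank $k$ and graph $G$. (2) There exists a cyclically symmetric orthogonal representation for $G$ over $\mathbb R$ with rank $k$. (3) There exists a polynomial $p\in\mathbb R_{\ge0}[z]$ whose normalized coefficient vector has weight $k$ such that $$\operatorname{Re}(p(\omega^j))=0\iff j\notin S\quad\text{for all } j\in\{1,2,\dots,n-1\}.$$ (4) There exists a polynomial $p\in\mathbb R_{\ge0}[z]$ whose normalized coefficient vector is balanced and has support of size $k$ such that $$p(\omega^j)=0\iff j\notin S\quad\text{for all } j\in\{1,2,\dots,n-1\}.$$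
   Context: Vectors and matrices are indexed from $0$. $\operatorname{Circ}(n,S)$ is the simple graph on $\{0,1,\dots,n-1\}$ in which $i,j$ are adjacent iff $(i-j)\bmod n\in S$. An $n\times n$ Hermitian (or real symmetric) matrix $A$ has graph $G$ (where $V(G)=\{0,\dots,n-1\}$) if for all $i\ne j$: $A_{ij}\neq 0$ iff $\{i,j\}\in E(G)$; diagonal entries are unrestricted. $A$ is a circulant matrix if $A_{ij}$ depends only on $i-j$ modulo $n$. An orthogonal representation for $G$ in $\mathbb R^d$ is a function $r:V(G)\to\mathbb R^d$ such that for distinct vertices $v,w$: $\langle r(v),r(w)\rangle\neq 0$ iff $\{v,w\}\in E(G)$. It is said to be over $\mathbb R$ (with $d$ arbitrary); its rank is the dimension of the span of its image. It is cyclically symmetric if there are a $d\times d$ unitary matrix $U$ with $U^n=I$ and a vector $x$ such that $r(i)=U^i x$ for all $i\in\{0,\dots,n-1\}$ (in the real case $U$ can equivalently be taken real orthogonal). $\mathbb R_{\ge 0}[z]$ is the set of real polynomials with all coefficients nonnegative (including the zero polynomial). For $p=\sum_m a_m z^m\in\mathbb R_{\ge 0}[z]$, put $b_i=\sum_{m\equiv i \bmod n}a_m$ for $0\le i\le n-1$; the normalized coefficient vector of $p$ is $(\sqrt{b_0},\dots,\sqrt{b_{n-1}})\in\mathbb R^n$. The support $\operatorname{supp}(x)$ is the set of indices of nonzero coordinates. The weight of $x\in\mathbb R^n$ is the number of $i\in\{0,\dots,n-1\}$ with $i\in\operatorname{supp}(x)$ or $n-i\in\operatorname{supp}(x)$.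 The vector $x$ is balanced if $x_i=x_{n-i}$ for all $i\in\{1,\dots,n-1\}$. *)

(* Defs.v *)
From mathcomp Require Import all_boot all_order all_algebra.
From mathcomp Require Import reals trigo.
From mathcomp Require Import complex.

Set Implicit Arguments.
Unset Strict Implicit.
Unset Printing Implicit Defensive.

Import Order.TTheory GRing.Theory Num.Theory.

Local Open Scope ring_scope.

(* A positive integer is written n.+1: the type 'I_n.+1 is then canonically
   the additive group of integers modulo n.+1, so that i - j and - i below
   are computed modulo n.+1. *)

Definition circ_graph (n : nat) (S : {set 'I_n.+1}) : rel 'I_n.+1 :=
  fun i j => i - j \in S.

Definition has_graph (R : realType) (n : nat) (A : 'M[R]_n) (G : rel 'I_n) :
    Prop :=
  forall i j : 'I_n, i != j -> (A i j != 0) = G i j.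

Definition circulant (R : realType) (n : nat) (A : 'M[R]_n.+1) : Prop :=
  forall i j i' j' : 'I_n.+1, i - j = i' - j' -> A i j = A i' j'.

Definition psdmx (R : realType) (n : nat) (A : 'M[R]_n) : Prop :=
  A^T = A /\ forall x : 'cV[R]_n, 0 <= (x^T *m A *m x) 0 0.

Definition dotv (R : realType) (d : nat) (u v : 'cV[R]_d) : R :=
  \sum_(l < d) u l 0 * v l 0.

Definition orth_rep (R : realType) (T : finType) (G : rel T) (d : nat)
    (r : T -> 'cV[R]_d) : Prop :=
  forall v w : T, v != w -> (dotv (r v) (r w) != 0) = G v w.

Definition rep_rank (R : realType) (T : finType) (d : nat)
    (r : T -> 'cV[R]_d) : nat :=
  \dim <<codom r>>%VS.

(* The unitary matrix and the vector are complex, even though r is real. *)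
Definition cyclically_symmetric (R : realType) (n d : nat)
    (r : 'I_n -> 'cV[R]_d) : Prop :=
  exists (U : 'M[R[i]]_d) (x : 'cV[R[i]]_d),
    [/\ U \is unitarymx, U ^+ n = 1
      & forall i : 'I_n, map_mx (real_complex R) (r i) = U ^+ i *m x].

Definition omega (R : realType) (n : nat) : R[i] :=
  Complex (cos (2 * pi / n%:R)) (sin (2 * pi / n%:R)).

Definition evalC (R : realType) (p : {poly R}) (z : R[i]) : R[i] :=
  (map_poly (real_complex R) p).[z].

Definition norm_coef_vec (R : realType) (n : nat) (p : {poly R}) : 'rV[R]_n :=
  \row_(i < n)
    Num.sqrt (\sum_(m < size p | m == i %[mod n]) p`_m).

Definition supp (R : realType) (n : nat) (x : 'rV[R]_n) : {set 'I_n} :=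
  [set i | x 0 i != 0].

(* At i = 0 one has - i = 0 rather than the non-index n; this leaves the
   count unchanged. *)
Definition weight (R : realType) (n : nat) (x : 'rV[R]_n.+1) : nat :=
  #|[set i : 'I_n.+1 | (i \in supp x) || (- i \in supp x)]|.

Definition balanced (R : realType) (n : nat) (x : 'rV[R]_n.+1) : Prop :=
  forall i : 'I_n.+1, i != 0 -> x 0 i = x 0 (- i).

(* Main.v *)
Require Import Defs.
From mathcomp Require Import all_boot all_order all_algebra.
From mathcomp Require Import reals trigo.
From mathcomp Require Import complex.
From mathcomp Require Import fingroup perm lra.

Set Implicit Arguments.
Unset Strict Implicit.
Unset Printing Implicit Defensive.

Import Order.TTheory GRing.Theory Num.Theory VectorInternalTheory.

Local Open Scope ring_scope.
Local Open Scope sesquilinear_scope.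
Local Notation "x %:C" := (real_complex _ x) : ring_scope.

(** Write N for n.+1. A real symmetric circulant matrix is a function c on
    the integers modulo N with c (- t) = c t, and the discrete Fourier
    transform diagonalizes all such matrices at once: c is the transform of its
    spectrum b, which is again a real symmetric function, and the matrix is
    F D F* with D the diagonal matrix of b and F a multiple of a unitary
    matrix. So its rank is the number of nonzero values of b
    ([rank_circmx_Re_dft]) and it is positive semidefinite exactly when b is
    nonnegative ([circulant_spectrum], [psd_circmx_Re_dft]).

    Evaluating a polynomial p at the powers of omega sees only its coefficients
    folded modulo N ([evalC_omega]): p(omega^j) is the Fourier transform of
    the folded vector. A polynomial with nonnegative coefficients is thus the
    spectrum of a positive semidefinite circulant matrix, provided that the
    folded vector is symmetric, that is, balanced; the entries of the matrix are
    the values p(omega^j), and the vanishing condition says that its graph is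
    the circulant graph. So a balanced polynomial yields a matrix. A polynomial
    that is not balanced becomes so on adding to its folded vector the
    reflection: the values of the transform become twice their real parts
    ([Re_dft_addN]), and the support becomes the set counted by the weight.

    Matrices and representations correspond by Gram matrices. The Gram matrix of
    a cyclically symmetric representation is circulant because U is unitary of
    order dividing N ([gram_circulant]), and it has the rank of the
    representation, so its spectrum is the polynomial wanted. Conversely,
    the positive semidefinite square root of a circulant matrix is circulant
    ([circmx_Re_dft_factor]); its columns represent the graph, and the cyclic
    shift permutes them ([circmx_cols_symmetric]). *)

(** * Characters of the integers modulo N *)

Lemma omegaX (R : realType) (N k : nat) :
  omega R N ^+ k =
  Complex (cos (2 * pi / N%:R * k%:R)) (sin (2 * pi / N%:R * k%:R)).
Proof.
elim: k => [|k IH]; first by rewrite mulr0 cos0 sin0.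
rewrite exprS IH /omega; set t := 2 * pi / N%:R.
rewrite -(natr1 k) mulrDr mulr1 cosD sinD.
by apply/eqP; rewrite eq_complex /=; apply/andP; split; apply/eqP; lra.
Qed.

(** If omega had order m < N, the angle t = pi * m / N would lie strictly
    between 0 and pi and satisfy cos (2 t) = 1, so sin t = 0, which is
    impossible there. *)
Lemma omega_primitive (R : realType) (n : nat) :
  n.+1.-primitive_root (omega R n.+1).
Proof.
have omega1 : omega R n.+1 ^+ n.+1 = 1.
  rewrite omegaX mulfVK ?pnatr_eq0 // mulr_natl cos2pi.
  by rewrite -[pi *+ 2]add0r sinD2pi sin0.
have [m prim_m m_dvd] := prim_order_exists (ltn0Sn n) omega1.
have m_gt0 := prim_order_gt0 prim_m.
have := dvdn_leq (ltn0Sn n) m_dvd; rewrite leq_eqVlt => /predU1P[m_eq|m_lt].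
  by move: prim_m; rewrite m_eq.
have := prim_expr_order prim_m; rewrite omegaX => /eqP.
rewrite eq_complex /= => /andP[/eqP cos1 _].
pose t : R := pi / n.+1%:R * m%:R.
have t_bounds : 0 < t < pi.
  apply/andP; split; first by rewrite /t !mulr_gt0 ?pi_gt0 ?invr_gt0 ?ltr0n.
  by rewrite /t mulrAC ltr_pdivrMr ?ltr0n // ltr_pM2l ?pi_gt0 // ltr_nat.
have := sin_gt0_pi t_bounds; move: cos1.
have -> : 2 * pi / n.+1%:R * m%:R = t *+ 2 by rewrite -[t *+ 2]mulr_natl /t !mulrA.
rewrite cos_mulr2n cos2sin2 => sin0 sint.
have : sin t ^+ 2 = 0 by lra.
by move/eqP; rewrite expf_eq0 /= gt_eqF.
Qed.

Definition chi (R : realType) (n : nat) (i j : 'I_n.+1) : R[i] :=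
  omega R n.+1 ^+ (i * j).

Arguments chi R {n}.

Lemma chiC (R : realType) (n : nat) (i j : 'I_n.+1) : chi R i j = chi R j i.
Proof. by rewrite /chi mulnC. Qed.

(** The exponents i * (j + k) and i * j + i * k are equal only modulo N, which
    is enough because omega ^+ N = 1. *)
Lemma chiDr (R : realType) (n : nat) (i j k : 'I_n.+1) :
  chi R i (j + k) = chi R i j * chi R i k.
Proof.
rewrite /chi !exprM /= -exprD expr_mod //.
by rewrite -exprM mulnC exprM (prim_expr_order (omega_primitive R n)) expr1n.
Qed.

Lemma chi0r (R : realType) (n : nat) (i : 'I_n.+1) : chi R i 0 = 1.
Proof. by rewrite /chi muln0. Qed.

Lemma omega_conj (R : realType) (N k : nat) :
  omega R N ^+ k * (omega R N ^+ k)^* = 1.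
Proof.
rewrite omegaX; have := cos2Dsin2 (2 * pi / N%:R * k%:R : R).
set c := cos _; set s := sin _ => cs1.
by apply/eqP; rewrite eq_complex /=; apply/andP; split; apply/eqP; lra.
Qed.

Lemma chiNr (R : realType) (n : nat) (i j : 'I_n.+1) :
  chi R i (- j) = (chi R i j)^*.
Proof.
have chi_conj : chi R i j * (chi R i j)^* = 1 by exact: omega_conj.
have chi_neq0 : chi R i j != 0.
  by apply: contra_eqN chi_conj => /eqP->; rewrite mul0r eq_sym oner_eq0.
by apply: (mulfI chi_neq0); rewrite -chiDr subrr chi0r chi_conj.
Qed.

(** Orthogonality of characters: for j != 0 this is a geometric sum whose ratio
    omega ^+ j differs from 1. *)
Lemma sum_chi (R : realType) (n : nat) (j : 'I_n.+1) :
  \sum_m chi R m j = (n.+1)%:R *+ (j == 0).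
Proof.
case: eqP => [-> | /eqP j_neq0].
  under eq_bigr do rewrite chi0r.
  by rewrite sumr_const card_ord.
have z_neq1 : omega R n.+1 ^+ j != 1.
  rewrite -(prim_order_dvd (omega_primitive R n)) gtnNdvd //.
  by rewrite lt0n; apply: contra_neq j_neq0 => j0; apply: val_inj.
have := subrX1 (omega R n.+1 ^+ j) n.+1.
rewrite -exprM mulnC exprM (prim_expr_order (omega_primitive R n)) expr1n.
rewrite subrr => /esym/eqP; rewrite mulf_eq0 subr_eq0 (negbTE z_neq1) /=.
move=> /eqP sum0; rewrite mulr0n -[RHS]sum0; apply: eq_bigr => m _.
by rewrite /chi mulnC exprM.
Qed.

(** * Fourier transform of real symmetric functions *)

Definition symmetric_fun (T : Type) (n : nat) (b : 'I_n.+1 -> T) : Prop :=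
  forall m, b (- m) = b m.

(** The real part of the Fourier transform. On symmetric functions it is the
    whole transform ([Re_dft_complex]), and it keeps matrix entries in R. *)
Definition Re_dft (R : realType) (n : nat) (b : 'I_n.+1 -> R) (j : 'I_n.+1) : R :=
  \sum_m b m * complex.Re (chi R m j).

Definition circmx (T : Type) (n : nat) (c : 'I_n.+1 -> T) : 'M[T]_n.+1 :=
  \matrix_(i, j) c (i - j).

Lemma Re_sum (R : realType) (I : finType) (f : I -> R[i]) :
  complex.Re (\sum_i f i) = \sum_i complex.Re (f i).
Proof. by elim/big_rec2: _ => [//|i x y _ <-]; case: y (f i) => [? ?] []. Qed.

Lemma Re_scale (R : realType) (a : R) (z : R[i]) :
  complex.Re (a%:C * z) = a * complex.Re z.
Proof. by case: z => x y /=; rewrite mul0r subr0. Qed.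

Lemma conjC_scale (R : realType) (a : R) (z : R[i]) :
  (a%:C * z)^* = a%:C * z^*.
Proof. by rewrite rmorphM; congr (_ * _); exact: conjc_real. Qed.

Lemma Re_dftE (R : realType) (n : nat) (b : 'I_n.+1 -> R) (j : 'I_n.+1) :
  Re_dft b j = complex.Re (\sum_m (b m)%:C * chi R m j).
Proof. by rewrite Re_sum; apply: eq_bigr => m _; rewrite Re_scale. Qed.

(** Conjugation exchanges the terms of index m and - m, so the sum is its own
    conjugate. *)
Lemma Re_dft_complex (R : realType) (n : nat) (b : 'I_n.+1 -> R) (j : 'I_n.+1) :
  symmetric_fun b -> (Re_dft b j)%:C = \sum_m (b m)%:C * chi R m j.
Proof.
move=> bN; rewrite Re_dftE; set z := \sum_m _.
have z_real : z^* = z.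
  rewrite /z rmorph_sum /= (reindex_inj oppr_inj) /=; apply: eq_bigr => m _.
  by rewrite conjC_scale bN [chi R (- m) j]chiC -chiNr opprK chiC.
case: z z_real => x y /= /eqP; rewrite eq_complex /= => /andP[_ /eqP yN].
by apply/eqP; rewrite eq_complex /= eqxx /=; apply/eqP; lra.
Qed.

Lemma Re_dft_symmetric (R : realType) (n : nat) (b : 'I_n.+1 -> R) :
  symmetric_fun (Re_dft b).
Proof.
move=> j; apply: eq_bigr => m _; congr (_ * _).
by rewrite chiNr; case: (chi R m j).
Qed.

(** Fourier inversion; the reflection of the argument that the double transform
    produces in general disappears because c is symmetric. *)
Lemma Re_dftK (R : realType) (n : nat) (c : 'I_n.+1 -> R) (j : 'I_n.+1) :
  symmetric_fun c -> Re_dft (Re_dft c) j = n.+1%:R * c j.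
Proof.
move=> cN; apply: (@complexI R).
rewrite (Re_dft_complex _ (@Re_dft_symmetric _ _ c)).
under eq_bigr do rewrite Re_dft_complex // mulr_suml.
rewrite exchange_big /=.
transitivity (\sum_t (c t)%:C * \sum_m chi R m (t + j)).
  apply: eq_bigr => t _; rewrite mulr_sumr; apply: eq_bigr => m _.
  by rewrite chiDr mulrA [chi R m t]chiC.
under eq_bigr do rewrite sum_chi.
rewrite (bigD1 (- j)) //= addNr eqxx big1 ?addr0 => [|t tNj].
  by rewrite cN mulrC rmorphM /= rmorph_nat.
by rewrite -(subr_eq0 _ (- j)) opprK in tNj; rewrite (negbTE tNj) mulr0.
Qed.

Lemma Re_dftZ (R : realType) (n : nat) (a : R) (c : 'I_n.+1 -> R) (j : 'I_n.+1) :
  Re_dft (fun m => a * c m) j = a * Re_dft c j.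
Proof. by rewrite mulr_sumr; apply: eq_bigr => m _; rewrite mulrA. Qed.

(** * Diagonalization of circulant matrices *)

Definition dft_matrix (R : realType) (n : nat) : 'M[R[i]]_n.+1 :=
  \matrix_(i, m) chi R m i.

(** The conjugate transpose of [dft_matrix], since chi m (- i) is the conjugate
    of chi m i. *)
Definition dft_adjoint (R : realType) (n : nat) : 'M[R[i]]_n.+1 :=
  \matrix_(m, i) chi R m (- i).

Lemma dft_adjointM (R : realType) (n : nat) :
  dft_adjoint R n *m dft_matrix R n = (n.+1%:R)%:M.
Proof.
apply/matrixP=> i j; rewrite !mxE.
transitivity (\sum_m chi R m (j - i)); last by rewrite sum_chi subr_eq0 eq_sym.
apply: eq_bigr => m _; rewrite !mxE chiDr !chiNr mulrC chiC.
by rewrite [chi R i m]chiC.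
Qed.

(** The columns of [dft_matrix] are common eigenvectors of all circulant
    matrices, because m |-> chi m (i - j) splits as a product in i and j. *)
Lemma circmx_Re_dft (R : realType) (n : nat) (b : 'I_n.+1 -> R) :
  symmetric_fun b ->
  map_mx (real_complex R) (circmx (Re_dft b)) =
    dft_matrix R n *m diag_mx (\row_m (b m)%:C) *m dft_adjoint R n.
Proof.
move=> bN; apply/matrixP=> i j; rewrite !mxE Re_dft_complex //.
apply: eq_bigr => m _; rewrite mul_mx_diag !mxE chiDr mulrA.
by rewrite [chi R m i * _]mulrC.
Qed.

(** Products of symmetric circulant matrices multiply spectra pointwise; the
    factor N comes from [dft_matrix] not being normalized. *)
Lemma circmx_Re_dftM (R : realType) (n : nat) (b b' : 'I_n.+1 -> R) :
  symmetric_fun b -> symmetric_fun b' ->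
  circmx (Re_dft b) *m circmx (Re_dft b') =
    n.+1%:R *: circmx (Re_dft (fun m => b m * b' m)).
Proof.
move=> bN b'N; apply: (map_mx_inj (f := real_complex R)).
rewrite map_mxM map_mxZ !circmx_Re_dft // => [|m]; last by rewrite bN b'N.
rewrite -!mulmxA (mulmxA (dft_adjoint R n)) dft_adjointM.
rewrite mul_scalar_mx rmorph_nat -!scalemxAr !(mulmxA (diag_mx _)) mulmx_diag.
by congr (_ *: (_ *m (diag_mx _ *m _))); apply/rowP=> m; rewrite !mxE rmorphM.
Qed.

Lemma rank_sum (F : fieldType) (m p : nat) (I : finType) (P : pred I)
    (A : I -> 'M[F]_(m, p)) :
  (\rank (\sum_(i | P i) A i)%R <= \sum_(i | P i) \rank (A i))%N.
Proof.
elim/big_rec2: _ => [|i r B _ rank_le]; first by rewrite mxrank0.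
by apply: leq_trans (mxrank_add _ _) _; rewrite leq_add2l.
Qed.

(** A diagonal matrix is a sum of one rank-one matrix per nonzero entry, which
    bounds its rank from above. The lower bound is subadditivity of the rank,
    applied to diag d plus the indicator matrix of the zeros of d, an invertible
    sum whose second term has rank at most the number of zeros. *)
Lemma rank_diag (F : fieldType) (n : nat) (d : 'rV[F]_n) :
  \rank (diag_mx d) = #|[set i | (d 0 i != 0)%R]|.
Proof.
have rank_le (e : 'rV[F]_n) :
    (\rank (diag_mx e) <= #|[set i | (e 0 i != 0)%R]|)%N.
  rewrite -sum1_card.
  have -> : diag_mx e =
      \sum_(i in [set i | (e 0 i != 0)%R]) e 0 i *: delta_mx i i.
    rewrite diag_mx_sum_delta [RHS]big_mkcond /=; apply: eq_bigr => i _.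
    by rewrite inE; case: eqP => [-> | //]; rewrite scale0r.
  apply: leq_trans (rank_sum _ _) _; apply: leq_sum => i _.
  apply: leq_trans (mxrankS (scalemx_sub _ (submx_refl _))) _.
  by rewrite mxrank_delta.
pose d' := \row_i (d 0 i == 0)%:R : 'rV[F]_n.
have rank_d' : (\rank (diag_mx d') <= n - #|[set i | (d 0 i != 0)%R]|)%N.
  apply: leq_trans (rank_le d') _.
  rewrite -[n in (n - _)%N]card_ord -(cardsC [set i | d 0 i != 0]) addKn.
  apply: subset_leq_card.
  by apply/subsetP=> i; rewrite !inE mxE; case: (d 0 i == 0); rewrite ?eqxx.
have full : \rank (diag_mx (d + d')) = n.
  apply: mxrank_unit; rewrite unitmxE det_diag unitfE.
  apply/prodf_neq0 => i _; rewrite !mxE.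
  by case: (eqVneq (d 0 i) 0) => [-> | d_neq0]; rewrite ?add0r ?oner_eq0 ?addr0.
have card_le : (#|[set i | (d 0 i != 0)%R]| <= n)%N.
  by rewrite -[n in (_ <= n)%N]card_ord max_card.
apply/eqP; rewrite eqn_leq rank_le /= -(leq_add2r (n - #|[set i | (d 0 i != 0)%R]|)).
rewrite subnKC // -[X in (X <= _)%N]full raddfD /=.
by apply: leq_trans (mxrank_add _ _) _; rewrite leq_add2l.
Qed.

Lemma rank_circmx_Re_dft (R : realType) (n : nat) (b : 'I_n.+1 -> R) :
  symmetric_fun b -> \rank (circmx (Re_dft b)) = #|[set m | b m != 0]|.
Proof.
move=> bN; rewrite -(mxrank_map (real_complex R)) circmx_Re_dft //.
have N_unit : (n.+1%:R : R[i]) \is a GRing.unit by rewrite unitfE pnatr_eq0.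
have adjF_unit : dft_adjoint R n *m dft_matrix R n \in unitmx.
  by rewrite dft_adjointM unitmxE det_scalar unitrX.
move: adjF_unit; rewrite unitmx_mul => /andP[adj_unit F_unit].
rewrite mxrankMfree ?row_free_unit // eqmxMfull ?row_full_unit // rank_diag.
apply: eq_card => m; rewrite !inE mxE.
by rewrite -(inj_eq (@complexI R)).
Qed.

Lemma circmx_tr (T : Type) (n : nat) (c : 'I_n.+1 -> T) :
  symmetric_fun c -> (circmx c)^T = circmx c.
Proof. by move=> cN; apply/matrixP=> i j; rewrite !mxE -opprB cN. Qed.

Lemma circmx_circulant (R : realType) (n : nat) (c : 'I_n.+1 -> R) :
  circulant (circmx c).
Proof. by move=> i j i' j' eq_ij; rewrite !mxE eq_ij. Qed.

(** * Gram matrices *)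

Lemma gram_psd (R : realType) (m p : nat) (M : 'M[R]_(m, p)) :
  psdmx (M^T *m M).
Proof.
split=> [|x]; first by rewrite trmx_mul trmxK.
rewrite mulmxA -mulmxA -trmx_mul mxE; apply: sumr_ge0 => i _.
by rewrite mxE -expr2 sqr_ge0.
Qed.

(** The kernels agree: if u M^T M = 0 then the squared norm of u M^T is zero,
    and over the reals this forces u M^T = 0. *)
Lemma rank_gram (R : realType) (m p : nat) (M : 'M[R]_(m, p)) :
  \rank (M^T *m M) = \rank M.
Proof.
apply/eqP; rewrite eqn_leq mxrankM_maxr /=.
rewrite -mxrank_tr -[\rank (_ *m _)]mxrank_tr trmx_mul trmxK.
suff ker_le : (kermx (M^T *m M) <= kermx M^T)%MS.
  move/mxrankS: ker_le; rewrite !mxrank_ker => ker_le.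
  rewrite -(leq_add2r (p - \rank M^T)) subnKC ?rank_leq_row //.
  by rewrite -{1}(subnKC (rank_leq_row (M^T *m M))) leq_add2l.
apply/rV_subP => u /sub_kermxP uMM; apply/sub_kermxP.
have /matrixP/(_ 0 0) : (u *m M^T) *m (u *m M^T)^T = 0.
  by rewrite trmx_mul trmxK mulmxA -(mulmxA u) uMM mul0mx.
rewrite !mxE => /eqP; rewrite psumr_eq0 => [/allP sum0|i _]; last first.
  by rewrite [_^T _ _]mxE -expr2 sqr_ge0.
apply/rowP=> i; have := sum0 i (mem_index_enum i).
by rewrite [_^T _ _]mxE -expr2 sqrf_eq0 [RHS]mxE => /eqP.
Qed.

(** * Spectra of positive semidefinite circulant matrices *)

Lemma chi_mul_conj_Re (R : realType) (n : nat) (m i j : 'I_n.+1) :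
  complex.Re (chi R m (i - j)) =
    complex.Re (chi R m i) * complex.Re (chi R m j)
    + complex.Im (chi R m i) * complex.Im (chi R m j).
Proof.
rewrite chiDr chiNr; case: (chi R m i) (chi R m j) => [x y] [x' y'] /=.
by rewrite mulrN opprK.
Qed.

(** The real and imaginary parts of the eigenvector of index m are two real
    vectors; the quadratic form takes on them values of sum N * Re_dft c m. *)
Lemma psd_circmx_spectrum_ge0 (R : realType) (n : nat) (c : 'I_n.+1 -> R)
    (m : 'I_n.+1) :
  psdmx (circmx c) -> 0 <= Re_dft c m.
Proof.
case=> _ psd.
pose x : 'cV[R]_n.+1 := \col_i complex.Re (chi R m i).
pose y : 'cV[R]_n.+1 := \col_i complex.Im (chi R m i).
have quad (z : 'cV[R]_n.+1) : (z^T *m circmx c *m z) 0 0 =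
    \sum_j \sum_i c (i - j) * (z i 0 * z j 0).
  rewrite mxE; apply: eq_bigr => j _; rewrite mxE mulr_suml.
  by apply: eq_bigr => i _; rewrite !mxE mulrAC mulrC.
suff : (x^T *m circmx c *m x) 0 0 + (y^T *m circmx c *m y) 0 0 =
    n.+1%:R * Re_dft c m.
  move=> sum_eq; have := addr_ge0 (psd x) (psd y).
  by rewrite sum_eq pmulr_rge0 // ltr0n.
rewrite !quad -big_split /= -[n.+1 in RHS]card_ord -sumr_const mulr_suml.
apply: eq_bigr => j _; rewrite -big_split mul1r /= (reindex_inj (addIr j)) /=.
apply: eq_bigr => i _; rewrite addrK -mulrDr !mxE -chi_mul_conj_Re addrK.
by rewrite chiC.
Qed.

(** The first column c of A determines A, and the transform of c, divided by N,
    is the spectrum, by Fourier inversion. *)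
Lemma circulant_spectrum (R : realType) (n : nat) (A : 'M[R]_n.+1) :
  psdmx A -> circulant A ->
  exists b : 'I_n.+1 -> R,
    [/\ symmetric_fun b, forall m, 0 <= b m & A = circmx (Re_dft b)].
Proof.
move=> psdA circA; pose c t := A t 0.
have A_circ : A = circmx c.
  by apply/matrixP=> i j; rewrite mxE; apply: circA; rewrite subr0.
have cN : symmetric_fun c.
  by move=> t; rewrite /c -[in RHS]psdA.1 mxE; apply: circA; rewrite subr0 sub0r.
exists (fun m => n.+1%:R^-1 * Re_dft c m); split=> [m|m|].
- by rewrite Re_dft_symmetric.
- by rewrite mulr_ge0 ?invr_ge0 ?ler0n // psd_circmx_spectrum_ge0 // -A_circ.
rewrite A_circ; apply/matrixP=> i j; rewrite !mxE Re_dftZ Re_dftK //.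
by rewrite mulKf // pnatr_eq0.
Qed.

(** The square root of a positive semidefinite symmetric circulant matrix is
    the symmetric circulant matrix whose spectrum is the square root of b, up to
    the normalization by N of [circmx_Re_dftM]. *)
Lemma circmx_Re_dft_factor (R : realType) (n : nat) (b : 'I_n.+1 -> R) :
  symmetric_fun b -> (forall m, 0 <= b m) ->
  exists h : 'I_n.+1 -> R,
    [/\ symmetric_fun h, \rank (circmx h) = #|[set m | b m != 0]|
      & circmx (Re_dft b) = (circmx h)^T *m circmx h].
Proof.
move=> bN b_ge0; pose a m := Num.sqrt (b m / n.+1%:R).
have aN : symmetric_fun a by move=> m; rewrite /a bN.
exists (Re_dft a); split; first exact: Re_dft_symmetric.
  rewrite rank_circmx_Re_dft //; apply: eq_card => m; rewrite !inE sqrtr_eq0 -ltNge.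
  by rewrite pmulr_lgt0 ?invr_gt0 ?ltr0n // lt_def b_ge0 andbT.
rewrite circmx_tr; last exact: Re_dft_symmetric.
rewrite circmx_Re_dftM //; apply/matrixP=> i j; rewrite !mxE -Re_dftZ.
apply: eq_bigr => m _; congr (_ * _).
by rewrite -expr2 sqr_sqrtr ?divr_ge0 ?ler0n // mulrC divfK // pnatr_eq0.
Qed.

Lemma psd_circmx_Re_dft (R : realType) (n : nat) (b : 'I_n.+1 -> R) :
  symmetric_fun b -> (forall m, 0 <= b m) -> psdmx (circmx (Re_dft b)).
Proof.
move=> bN b_ge0; have [h [_ _ ->]] := circmx_Re_dft_factor bN b_ge0.
exact: gram_psd.
Qed.

Lemma has_graph_circmx (R : realType) (n : nat) (S : {set 'I_n.+1})
    (c : 'I_n.+1 -> R) :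
  has_graph (circmx c) (circ_graph S) <->
  (forall j, j != 0 -> (c j = 0 <-> j \notin S)).
Proof.
split=> [graph j j_neq0|cS i j i_neq_j].
  have := graph j 0 j_neq0; rewrite mxE /circ_graph subr0 => <-.
  by rewrite negbK; split=> /eqP.
have := cS (i - j); rewrite subr_eq0 => /(_ i_neq_j) cS_ij.
rewrite mxE /circ_graph; apply/idP/idP; last first.
  by apply: contraTN => /eqP /cS_ij.
by apply: contraR => /cS_ij ->.
Qed.

(** The span is defined through the abstract coordinates v2r of the space of
    columns. The matrix L of v2r has a left inverse, so multiplying by it on the
    right turns the transposed matrix of columns into one that generates the
    span, without changing the rank. *)
Lemma dim_span_cols (R : realType) (d n : nat) (r : 'I_n -> 'cV[R]_d) :
  rep_rank r = \rank (\matrix_(i < d, j < n) r j i 0).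
Proof.
pose L : 'M_(d, _) := lin1_mx (@v2r R 'cV[R]_d \o trmx).
pose L' : 'M_(_, d) := lin1_mx (trmx \o @r2v R 'cV[R]_d).
have LK : L *m L' = 1%:M.
  apply/row_matrixP=> i; rewrite !rowE mulmxA !mul_rV_lin1 /= v2rK trmxK.
  by rewrite mulmx1.
have L_free : row_free L by apply/row_freeP; exists L'.
have span_r : <<codom r>>%VS = mx2vs (b2mx (in_tuple (codom r))).
  by rewrite unlock.
rewrite /rep_rank span_r /dimv mx2vsK.
rewrite -[RHS]mxrank_tr -(mxrankMfree _ L_free); set M := _^T.
have row_ML j : row j (M *m L) = v2r (r j).
  rewrite row_mul mul_rV_lin1 /=; congr v2r.
  by apply/matrixP=> l z; rewrite (ord1 z) !mxE.
apply: eqmx_rank; apply/andP; split; apply/row_subP => i.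
  have /codomP[j r_j] : tnth (in_tuple (codom r)) i \in codom r by exact: mem_tnth.
  by rewrite rowK r_j -row_ML row_sub.
have /tnthP[j r_j] : r i \in in_tuple (codom r) by exact: codom_f.
rewrite row_ML r_j; set B := b2mx _.
by have := row_sub j B; rewrite rowK.
Qed.

(** * Cyclically symmetric representations *)

Definition shift_index (n : nat) (i : 'I_n.+1) : 'I_n.+1 := i - inZp 1.

Lemma shift_index_inj (n : nat) : injective (@shift_index n).
Proof. exact: addIr. Qed.

Definition shift_mx (F : pzRingType) (n : nat) : 'M[F]_n.+1 :=
  perm_mx (perm (@shift_index_inj n)).

(** Left multiplication by a permutation matrix permutes rows; the power k of
    the shift moves them by k, read modulo N by inZp. *)
Lemma shift_mxX (F : pzRingType) (n p k : nat) (A : 'M[F]_(n.+1, p)) i j :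
  (shift_mx F n ^+ k *m A) i j = A (i - inZp k) j.
Proof.
elim: k i => [|k IH] i.
  rewrite expr0 mul1mx; congr (A _ j).
  by rewrite (_ : inZp 0 = 0) ?subr0 //; apply: val_inj; rewrite /= mod0n.
rewrite exprS -mulmxE -mulmxA -row_permE mxE IH permE /shift_index.
congr (A _ j); rewrite -addrA -opprD; congr (_ - _).
by apply: val_inj; rewrite /= modnDm add1n.
Qed.

Lemma shift_mx_order (F : pzRingType) (n : nat) : shift_mx F n ^+ n.+1 = 1.
Proof.
rewrite -[LHS]mulmx1; apply/matrixP=> i j; rewrite shift_mxX.
congr (1%:M _ j); rewrite (_ : inZp _ = 0) ?subr0 //.
by apply: val_inj; rewrite /= modnn.
Qed.

Lemma shift_mx_unitary (R : realType) (n : nat) :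
  shift_mx R[i] n \is unitarymx.
Proof.
apply/unitarymxP; rewrite /shift_mx tr_perm_mx map_perm_mx -perm_mxM.
by rewrite mulgV perm_mx1.
Qed.

(** Column i of a circulant matrix is column 0 moved down by i, so the complex
    shift matrix serves as U. *)
Lemma circmx_cols_symmetric (R : realType) (n : nat) (h : 'I_n.+1 -> R) :
  cyclically_symmetric (fun i => col i (circmx h)).
Proof.
exists (shift_mx R[i] n), (map_mx (real_complex R) (col 0 (circmx h))).
split; [exact: shift_mx_unitary | exact: shift_mx_order |] => i.
by apply/matrixP=> l z; rewrite shift_mxX valZpK !mxE subr0.
Qed.

Lemma unitarymxX (R : realType) (d k : nat) (U : 'M[R[i]]_d) :
  U \is unitarymx -> U ^+ k \is unitarymx.
Proof.
move=> U_unitary; elim: k => [|k IH]; last by rewrite exprS mul_unitarymx.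
by apply/unitarymxP; rewrite expr0 mul1mx trmx1 map_mx1.
Qed.

Lemma gram_entry (R : realType) (d n : nat) (r : 'I_n -> 'cV[R]_d) (i j : 'I_n) :
  let M := \matrix_(l < d, j < n) r j l 0 in (M^T *m M) i j = dotv (r i) (r j).
Proof. by rewrite /= mxE; apply: eq_bigr => l _; rewrite !mxE. Qed.

(** As U^j is unitary and U^i = U^j U^(i - j), the inner product of U^i x and
    U^j x equals that of U^(i - j) x and x. *)
Lemma gram_circulant (R : realType) (d n : nat) (r : 'I_n.+1 -> 'cV[R]_d) :
  cyclically_symmetric r ->
  let M := \matrix_(l < d, j < n.+1) r j l 0 in circulant (M^T *m M).
Proof.
case=> U [x [U_unitary U_order rE]] M.
suff gram_diff i j :
    ((M^T *m M) i j)%:C = (x^t* *m U ^+ (i - j)%R *m x) 0 0.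
  move=> i j i' j' eq_ij; apply: (@complexI R).
  by rewrite !gram_diff eq_ij.
have Ui : U ^+ i = U ^+ j *m U ^+ (i - j)%R.
  by rewrite mulmxE -exprD -(expr_mod (_ + _) U_order) -[in LHS](subrKC j i).
have conjU : (U ^+ j)^t* *m U ^+ j = 1%:M.
  by apply: mulmx1C; apply/unitarymxP; exact: unitarymxX.
have -> : x^t* *m U ^+ (i - j)%R *m x =
    (map_mx (real_complex R) (r j))^t* *m map_mx (real_complex R) (r i).
  rewrite !rE Ui trmx_mul map_mxM -!mulmxA; congr (_ *m _).
  by rewrite !mulmxA conjU mul1mx.
rewrite gram_entry mxE rmorph_sum; apply: eq_bigr => l _.
rewrite !mxE rmorphM mulrC; congr (_ * _).
by apply/eqP; rewrite eq_complex /= oppr0 !eqxx.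
Qed.

(** * Polynomials with nonnegative coefficients *)

Definition fold_coef (R : realType) (n : nat) (p : {poly R}) (i : 'I_n.+1) : R :=
  \sum_(m < size p | m == i %[mod n.+1]) p`_m.

Arguments fold_coef {R} n p i.

Lemma fold_coef_ge0 (R : realType) (n : nat) (p : {poly R}) (i : 'I_n.+1) :
  p \is a polyOver Num.nneg -> 0 <= fold_coef n p i.
Proof.
by move=> /polyOverP p_ge0; apply: sumr_ge0 => m _; have := p_ge0 m; rewrite nnegrE.
Qed.

Lemma norm_coef_vecE (R : realType) (n : nat) (p : {poly R}) (i : 'I_n.+1) :
  norm_coef_vec n.+1 p 0 i = Num.sqrt (fold_coef n p i).
Proof. by rewrite mxE. Qed.

Lemma in_supp_norm_coef (R : realType) (n : nat) (p : {poly R}) (i : 'I_n.+1) :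
  p \is a polyOver Num.nneg ->
  (i \in supp (norm_coef_vec n.+1 p)) = (fold_coef n p i != 0).
Proof.
move=> p_ge0; rewrite inE norm_coef_vecE sqrtr_eq0.
by rewrite -ltNge lt0r fold_coef_ge0 ?andbT.
Qed.

Lemma balanced_norm_coef (R : realType) (n : nat) (p : {poly R}) :
  p \is a polyOver Num.nneg ->
  balanced (norm_coef_vec n.+1 p) <-> symmetric_fun (fold_coef n p).
Proof.
move=> p_ge0; split=> [bal i|sym i _]; last by rewrite !norm_coef_vecE sym.
have [-> | i_neq0] := eqVneq i 0; first by rewrite oppr0.
apply/esym; have := bal i i_neq0; rewrite !norm_coef_vecE => /eqP.
by rewrite eqr_sqrt ?fold_coef_ge0 // => /eqP.
Qed.

(** Exponents congruent modulo N give the same power of omega ^+ j, so the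
    coefficients can be grouped by residue class. *)
Lemma evalC_omega (R : realType) (n : nat) (p : {poly R}) (j : 'I_n.+1) :
  evalC p (omega R n.+1 ^+ j) = \sum_i (fold_coef n p i)%:C * chi R i j.
Proof.
rewrite /evalC horner_coef size_map_inj_poly ?rmorph0 //; last exact: complexI.
rewrite (partition_big (fun m : 'I_(size p) => inZp m : 'I_n.+1) xpredT) //=.
apply: eq_bigr => i _; rewrite rmorph_sum mulr_suml; apply: eq_big => m.
  by rewrite -val_eqE /= [(i %% _)%N]modn_small.
move=> /eqP <-; rewrite coef_map /chi -exprM /=.
congr (_ * _); rewrite mulnC -[LHS](prim_expr_mod (omega_primitive R n)).
by rewrite -[RHS](prim_expr_mod (omega_primitive R n)) modnMml.
Qed.

Lemma Re_evalC_omega (R : realType) (n : nat) (p : {poly R}) (j : 'I_n.+1) :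
  complex.Re (evalC p (omega R n.+1 ^+ j)) = Re_dft (fold_coef n p) j.
Proof. by rewrite evalC_omega Re_dftE. Qed.

Lemma evalC_omega_symmetric (R : realType) (n : nat) (p : {poly R})
    (j : 'I_n.+1) :
  symmetric_fun (fold_coef n p) ->
  evalC p (omega R n.+1 ^+ j) = (Re_dft (fold_coef n p) j)%:C.
Proof. by move=> sym; rewrite evalC_omega Re_dft_complex. Qed.

(** Every nonnegative vector arises from a polynomial of degree less than N, for
    which folding does nothing. *)
Lemma poly_of_fold_coef (R : realType) (n : nat) (b : 'I_n.+1 -> R) :
  (forall i, 0 <= b i) ->
  exists2 p : {poly R}, p \is a polyOver Num.nneg & fold_coef n p =1 b.
Proof.
move=> b_ge0; pose p := \poly_(m < n.+1) b (inord m); exists p.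
  apply/polyOverP=> m; rewrite coef_poly nnegrE; case: ifP => // _; exact: b_ge0.
move=> i; have -> : fold_coef n p i = p`_i; last first.
  by rewrite coef_poly ltn_ord inord_val.
rewrite /fold_coef (big_ord_widen_cond n.+1 (fun m => m == i %[mod n.+1])
  (fun m => p`_m) (size_poly _ _)).
have [i_lt | i_ge] := ltnP i (size p).
  rewrite (big_pred1 i) // => m; rewrite /= !modn_small // -val_eqE /=.
  by case: eqP => //= ->.
rewrite big1 ?nth_default // => m /andP[]; rewrite !modn_small // => /eqP ->.
by rewrite ltnNge i_ge.
Qed.

(** Reflecting b conjugates its transform and so preserves the real part. *)
Lemma Re_dft_addN (R : realType) (n : nat) (b : 'I_n.+1 -> R) (j : 'I_n.+1) :
  Re_dft (fun m => b m + b (- m)) j = 2 * Re_dft b j.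
Proof.
rewrite /Re_dft; under eq_bigr do rewrite mulrDl.
rewrite big_split mulr2n mulrDl !mul1r /=; congr (_ + _).
rewrite (reindex_inj oppr_inj); apply: eq_bigr => m _ /=.
by rewrite opprK chiC chiNr chiC; case: (chi R m j).
Qed.

(** * The equivalence *)

Theorem theorem6p17 (R : realType) (n : nat) (S : {set 'I_n.+1})
    (S0 : 0 \notin S) (SN : forall s : 'I_n.+1, s \in S -> - s \in S)
    (k : nat) :
  [<-> exists A : 'M[R]_n.+1,
         [/\ psdmx A, circulant A, \rank A = k & has_graph A (circ_graph S)];
       exists (d : nat) (r : 'I_n.+1 -> 'cV[R]_d),
         [/\ orth_rep (circ_graph S) r, cyclically_symmetric r
           & rep_rank r = k];
       exists p : {poly R},
         [/\ p \is a polyOver Num.nneg,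
             weight (norm_coef_vec n.+1 p) = k
           & forall j : 'I_n.+1, j != 0 ->
               (complex.Re (evalC p (omega R n.+1 ^+ j)) = 0 <-> j \notin S)];
       exists p : {poly R},
         [/\ p \is a polyOver Num.nneg,
             balanced (norm_coef_vec n.+1 p),
             #|supp (norm_coef_vec n.+1 p)| = k
           & forall j : 'I_n.+1, j != 0 ->
               (evalC p (omega R n.+1 ^+ j) = 0 <-> j \notin S)]].
Proof.
tfae.
- case=> A [psdA circA rankA graphA].
  have [b [bN b_ge0 A_dft]] := circulant_spectrum psdA circA.
  have [h [hN rank_h A_h]] := circmx_Re_dft_factor bN b_ge0.
  (* By A_h, A is the Gram matrix of the columns of circmx h. *)
  exists n.+1, (fun i => col i (circmx h)).
  have h_cols : \matrix_(l, j) (col j (circmx h)) l 0 = circmx h.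
    by apply/matrixP=> l j; rewrite !mxE.
  split; last 1 first.
  + by rewrite dim_span_cols h_cols rank_h -rank_circmx_Re_dft // -A_dft.
  + move=> v w v_neq_w; rewrite -graphA // A_dft A_h.
    by have := gram_entry (fun i => col i (circmx h)) v w; rewrite /= h_cols => <-.
  + exact: circmx_cols_symmetric.
- case=> d [r [orth cyc rank_r]].
  pose M := \matrix_(l < d, j < n.+1) r j l 0.
  have gram_graph : has_graph (M^T *m M) (circ_graph S).
    by move=> v w v_neq_w; rewrite gram_entry; exact: orth.
  have [b [bN b_ge0 gram_dft]] :=
    circulant_spectrum (gram_psd M) (gram_circulant cyc).
  have [p p_nneg p_b] := poly_of_fold_coef b_ge0.
  exists p; split=> //.
    rewrite -rank_r dim_span_cols -rank_gram gram_dft rank_circmx_Re_dft //.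
    apply: eq_card => i.
    by rewrite [LHS]inE [RHS]inE !in_supp_norm_coef // !p_b bN orbb.
  move: gram_graph; rewrite gram_dft => /has_graph_circmx dft_S j j_neq0.
  rewrite Re_evalC_omega (_ : Re_dft _ j = Re_dft b j); first exact: dft_S.
  by apply: eq_bigr => m _; rewrite p_b.
- case=> p [p_nneg weight_p p_S].
  (* Nonnegativity prevents cancellation, so the support of b is that of the
     folded vector together with its reflection. *)
  pose b m := fold_coef n p m + fold_coef n p (- m).
  have fold_ge0 m : 0 <= fold_coef n p m by exact: fold_coef_ge0.
  have bN : symmetric_fun b by move=> m; rewrite /b opprK addrC.
  have b_ge0 m : 0 <= b m by rewrite addr_ge0.
  have [q q_nneg q_b] := poly_of_fold_coef b_ge0.
  have qN : symmetric_fun (fold_coef n q) by move=> m; rewrite !q_b bN.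
  exists q; split=> //; first exact/balanced_norm_coef.
    rewrite -weight_p; apply: eq_card => i.
    rewrite [RHS]inE !in_supp_norm_coef // q_b paddr_eq0 ?fold_ge0 //.
    by rewrite negb_and.
  move=> j j_neq0; rewrite evalC_omega_symmetric // -p_S // Re_evalC_omega.
  rewrite (_ : Re_dft _ j = 2 * Re_dft (fold_coef n p) j); last first.
    by rewrite -Re_dft_addN; apply: eq_bigr => m _; rewrite q_b.
  split=> [/eqP | ->]; last by rewrite mulr0.
  by rewrite (inj_eq (@complexI R)) mulf_eq0 pnatr_eq0 => /eqP.
- case=> p [p_nneg /balanced_norm_coef -/(_ p_nneg) bN supp_p p_S].
  have b_ge0 m : 0 <= fold_coef n p m by exact: fold_coef_ge0.
  exists (circmx (Re_dft (fold_coef n p))); split.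
  + exact: psd_circmx_Re_dft.
  + exact: circmx_circulant.
  + rewrite rank_circmx_Re_dft // -supp_p; apply: eq_card => i.
    by rewrite in_supp_norm_coef // inE.
  apply/has_graph_circmx => j j_neq0; rewrite -p_S // evalC_omega_symmetric //.
  by split=> [-> // | /complexI].
Qed.
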